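(* Let $(\overline u_i,\alpha_i)\in\mathbb{R}^s\times\{-1,1\}$, $i=1,\dots,m$, be nominal training data such that the nominal support vector machine problem is feasible, i.e. there is $(w,\gamma)\in\mathbb{R}^s\times\mathbb{R}$ with $\alpha_i(\overline u_i^Tw+\gamma)\ge1$ for $i=1,\dots,m$. For $r=(r_1,\dots,r_m)\in\mathbb{R}^m_+$, let $$F_r=\{(w,\gamma)\in\mathbb{R}^s\times\mathbb{R}:\ \alpha_i(u_i^Tw+\gamma)\ge1\ \ \forall u_i\in\overline u_i+r_i\mathbb{B}_s,\ i=1,\dots,m\}$$ be the feasible set of the robust support vector machine problem. Then $F_r\ne\emptyset$ for all $r\in\mathbb{R}^m_+$ with $r_i\le\frac{1}{\sqrt s+1}f^\ast$ for all $i=1,\dots,m$, where $f^\ast$ is the optimal value of the second-order cone program $$\inf_{(z,\sigma,t,\lambda)\in\mathbb{R}^{s+2}\times\mathbb{R}\times\mathbb{R}\times\mathbb{R}^{m+s+1}}\left\{t:\ \begin{array}{l}\|(z,\sigma)\|\le t,\ z=\overline A^T\lambda,\ \sigma\ge-\overline b^T\lambda,\\ \|(\lambda_1,\dots,\lambda_s)\|\le\lambda_{s+1},\\ \sum_{i=1}^{m+1}\lambda_{s+i}=1,\ \lambda_{s+1}\ge0,\dots,\lambda_{m+s+1}\ge0\end{array}\right\},$$ with $\overline A=[\overline a_1\mid\dots\mid\overline a_{m+s+1}]^T\in\mathbb{R}^{(m+s+1)\times(s+2)}$ and $\overline b\in\mathbb{R}^{m+s+1}$ given by: $\overline a_i=(-e_i^T,0,0)^T$,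 $\overline b_i=0$ for $i=1,\dots,s$; $\overline a_{s+1}=(0_s^T,0,-1)^T$, $\overline b_{s+1}=0$; and $\overline a_i=(-\alpha_{i-s-1}\overline u_{i-s-1}^T,-\alpha_{i-s-1},0)^T$, $\overline b_i=1$ for $i=s+2,\dots,m+s+1$.
   Context: $\|\cdot\|$ is the Euclidean norm, $\mathbb{B}_s$ is the closed Euclidean unit ball of $\mathbb{R}^s$, and $e_1,\dots,e_s$ is the canonical basis of $\mathbb{R}^s$. *)

(* Defs.v *)
From mathcomp Require Import all_boot all_order all_algebra.
From mathcomp Require Import all_classical all_reals all_analysis.

Set Implicit Arguments.
Unset Strict Implicit.
Unset Printing Implicit Defensive.

Import Order.TTheory GRing.Theory Num.Theory.
Local Open Scope classical_set_scope.
Local Open Scope ring_scope.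

(* The library norm `|x| on matrices is the sup norm, hence this definition. *)
Definition enorm (R : realType) (n : nat) (x : 'cV[R]_n) : R :=
  Num.sqrt (\sum_(i < n) x i 0 ^+ 2).

Definition eball (R : realType) (n : nat) : set 'cV[R]_n :=
  [set x | enorm x <= 1].

Definition dot (R : realType) (n : nat) (u v : 'cV[R]_n) : R :=
  (u^T *m v) 0 0.

Definition svm_feasible (R : realType) (s m : nat)
    (ubar : 'I_m -> 'cV[R]_s) (alpha : 'I_m -> R) : set ('cV[R]_s * R) :=
  [set wg | forall i, 1 <= alpha i * (dot (ubar i) wg.1 + wg.2)].

Definition robust_svm_feasible (R : realType) (s m : nat)
    (ubar : 'I_m -> 'cV[R]_s) (alpha : 'I_m -> R) (r : 'I_m -> R) :
    set ('cV[R]_s * R) :=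
  [set wg | forall i u, [set ubar i + r i *: b | b in @eball R s] u ->
    1 <= alpha i * (dot u wg.1 + wg.2)].

(* The index set {1, ..., m+s+1} is 'I_(s + (1 + m)): first the s indices of
   the basis vectors, then the single index s+1, then the m data points.
   Likewise R^(s+2) is 'cV_(s + (1 + 1)). *)
Definition Abar (R : realType) (s m : nat)
    (ubar : 'I_m -> 'cV[R]_s) (alpha : 'I_m -> R) :
    'M[R]_(s + (1 + m), s + (1 + 1)) :=
  col_mx (\matrix_(i < s) row_mx (- (delta_mx i 0 : 'cV[R]_s)^T) (row_mx 0 0))
    (col_mx (row_mx 0 (row_mx 0 (- 1)%:M))
      (\matrix_(i < m)
        row_mx (- alpha i *: (ubar i)^T) (row_mx (- alpha i)%:M 0))).

Definition bbar (R : realType) (s m : nat) : 'cV[R]_(s + (1 + m)) :=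
  col_mx 0 (col_mx 0 (const_mx 1)).

Definition socp_feasible (R : realType) (s m : nat)
    (ubar : 'I_m -> 'cV[R]_s) (alpha : 'I_m -> R)
    (z : 'cV[R]_(s + (1 + 1))) (sigma t : R)
    (lambda : 'cV[R]_(s + (1 + m))) : Prop :=
  [/\ enorm (col_mx z sigma%:M) <= t,
      z = (Abar ubar alpha)^T *m lambda,
      - dot (bbar R s m) lambda <= sigma,
      enorm (usubmx lambda) <= dsubmx lambda (lshift m ord0) 0 &
      \sum_(i < 1 + m) dsubmx lambda i 0 = 1 /\
      (forall i : 'I_(1 + m), 0 <= dsubmx lambda i 0)].

Definition socp_value (R : realType) (s m : nat)
    (ubar : 'I_m -> 'cV[R]_s) (alpha : 'I_m -> R) : \bar R :=
  ereal_inf [set t%:E | t in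
    [set t | exists z sigma lambda,
      socp_feasible ubar alpha z sigma t lambda]].

(* Main.v *)
(** Let [F] be the optimal value of the cone program, and let [K] be the convex
hull of the points [(alpha_i ubar_i, alpha_i)], thickened by the ball of radius
[F] in the first [s] coordinates.  If [F = 0] the nominal problem already is the
robust one.  If [F > 0], every point [k] of [K] yields, with weight
[lambda_{s+1} = F / (1 + F)] and [sigma = 0], a feasible point of the cone program
of value [sqrt (|k|^2 + F^2) / (1 + F)]; as this is at least [F], the set [K] stays
away from the origin.  A near-minimizer of the norm on [K] then
separates [K] from the origin, and a multiple of it is robustly feasible because
[r_i <= F / (sqrt s + 1) <= F]. *)
Require Import Defs.
From mathcomp Require Import all_boot all_order all_algebra.
From mathcomp Require Import all_classical all_reals all_analysis.
From mathcomp Require Import ring lra.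

Import Order.TTheory GRing.Theory Num.Theory.
Local Open Scope classical_set_scope.
Local Open Scope ring_scope.

(** * Inner product identities and separation of a convex set from the origin *)

Section Dot.
Variable R : realType.

Lemma dotE n (u v : 'cV[R]_n) : dot u v = \sum_i u i 0 * v i 0.
Proof. by rewrite /dot mxE; apply: eq_bigr => i _; rewrite mxE. Qed.

Lemma dotC n (u v : 'cV[R]_n) : dot u v = dot v u.
Proof. by rewrite !dotE; apply: eq_bigr => i _; rewrite mulrC. Qed.

Lemma dotDr n (u v w : 'cV[R]_n) : dot u (v + w) = dot u v + dot u w.
Proof. by rewrite /dot mulmxDr mxE. Qed.

Lemma dotZr n a (u v : 'cV[R]_n) : dot u (a *: v) = a * dot u v.
Proof. by rewrite /dot -scalemxAr mxE. Qed.

Lemma dotNr n (u v : 'cV[R]_n) : dot u (- v) = - dot u v.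
Proof. by rewrite -scaleN1r dotZr mulN1r. Qed.

Lemma dotDl n (u v w : 'cV[R]_n) : dot (v + w) u = dot v u + dot w u.
Proof. by rewrite !(dotC _ _ u) dotDr. Qed.

Lemma dotZl n a (u v : 'cV[R]_n) : dot (a *: v) u = a * dot v u.
Proof. by rewrite !(dotC _ _ u) dotZr. Qed.

Lemma dotNl n (u v : 'cV[R]_n) : dot (- v) u = - dot v u.
Proof. by rewrite !(dotC _ _ u) dotNr. Qed.

Lemma dot_col_mx n p (u v : 'cV[R]_n) (u' v' : 'cV[R]_p) :
  dot (col_mx u u') (col_mx v v') = dot u v + dot u' v'.
Proof. by rewrite /dot tr_col_mx mul_row_col mxE. Qed.

Lemma dot_scalar_mx (a b : R) : dot (a%:M : 'cV_1) b%:M = a * b.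
Proof. by rewrite dotE big_ord1 !mxE. Qed.

Lemma dot_ge0 n (u : 'cV[R]_n) : 0 <= dot u u.
Proof. by rewrite dotE sumr_ge0 // => i _; rewrite -expr2 sqr_ge0. Qed.

Lemma enormE n (u : 'cV[R]_n) : enorm u = Num.sqrt (dot u u).
Proof. by rewrite /enorm dotE; under eq_bigr do rewrite expr2. Qed.

Lemma enorm_le n (u : 'cV[R]_n) a : 0 <= a -> (enorm u <= a) = (dot u u <= a ^+ 2).
Proof.
by move=> a0; rewrite enormE -{1}(ger0_norm a0) -sqrtr_sqr ler_sqrt ?sqr_ge0.
Qed.

(** The gap between the two sides equals [(1 - t) (c - |u|^2) + t (c - |v|^2) + t (1 - t) |v -
    u|^2], a sum of nonnegative terms. *)
Lemma dot_conv_le n (u v : 'cV[R]_n) (t c : R) : 0 <= t <= 1 ->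
  dot u u <= c -> dot v v <= c ->
  dot (u + t *: (v - u)) (u + t *: (v - u)) <= c.
Proof.
move=> /andP[t0 t1] uc vc; have := dot_ge0 _ (v - u).
rewrite !(dotDl, dotDr, dotZl, dotZr, dotNl, dotNr) (dotC _ v u) => d0.
have : 0 <= (1 - t) * (c - dot u u) by rewrite mulr_ge0 ?subr_ge0.
have : 0 <= t * (c - dot v v) by rewrite mulr_ge0 ?subr_ge0.
have t1' : 0 <= 1 - t by rewrite subr_ge0.
have := mulr_ge0 (mulr_ge0 t0 t1') d0.
nra.
Qed.

(* With an almost minimal [v] of squared norm in [[d, d + eta]], expanding
   [d <= |v + tau (k - v)|^2] bounds [dot v k] from below by
   [d - tau |k - v|^2 / 2 - eta / (2 tau)]. *)
Lemma separate_from_origin n (K G : set 'cV[R]_n) (c M : R) :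
  (forall k k' t, K k -> K k' -> 0 <= t <= 1 -> K (k + t *: (k' - k))) ->
  0 < c -> (forall k, K k -> c <= dot k k) ->
  G `<=` K -> (forall k, G k -> dot k k <= M) ->
  exists v e, 0 < e /\ forall k, G k -> e <= dot v k.
Proof.
move=> Kconv c0 Kc GK GM.
have [[k0 Gk0]|G0] := pselect (G !=set0); last first.
  by exists 0, 1; split => // k Gk; case: G0; exists k.
pose S := [set dot k k | k in K].
have S0 : S !=set0 by exists (dot k0 k0), k0 => //; exact: GK.
have Slb : lbound S c by move=> _ [k Kk <-]; exact: Kc.
have Sinf : has_inf S by split => //; exists c.
set d := inf S.
have cd : c <= d by exact: lb_le_inf S0 Slb.
have d0 : 0 < d by apply: lt_le_trans cd.
have dle k : K k -> d <= dot k k.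
  by move=> Kk; apply: (@ge_inf _ S); [exists c|exists k].
have dM : d <= M by apply: le_trans (dle _ (GK _ Gk0)) (GM _ Gk0).
(* [B] will bound [|k - v|^2 = 2 |k|^2 + 2 |v|^2 - |k + v|^2] for [k] in [G], because the
   near-minimizer [v] chosen below has [|v|^2 <= 2 d]. *)
pose B := 2 * M + 4 * d.
have B0 : 0 < B by rewrite /B; lra.
(* With this step the quadratic term [tau^2 |k - v|^2] is at most [tau d / 2]. The slack allowed for
   [v] is also [tau d / 2], so dividing by [tau] leaves a total error of [d]. *)
pose tau := d / (2 * B).
have tau0 : 0 < tau by rewrite divr_gt0 // mulr_gt0.
have tauB : tau * (2 * B) = d by rewrite /tau divfK // gt_eqF // mulr_gt0.
have tau1 : tau <= 1 by rewrite /tau ler_pdivrMr ?mulr_gt0 // /B; lra.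
have [_ [v Kv <-] vd] := inf_adherent (mulr_gt0 (divr_gt0 tau0 (ltr0Sn R 1)) d0) Sinf.
rewrite -/d in vd.
exists v, (d / 2); split; first by rewrite divr_gt0.
move=> k Gk.
have kv : dot (k - v) (k - v) <= B.
  have := dot_ge0 _ (k + v); have := GM _ Gk.
  have : tau / 2 * d <= d by nra.
  rewrite !(dotDl, dotDr, dotNl, dotNr) (dotC _ v k) /B; lra.
have := dle _ (Kconv v k tau Kv (GK _ Gk) _).
rewrite (ltW tau0) tau1 => /(_ isT).
have -> : dot (v + tau *: (k - v)) (v + tau *: (k - v)) =
  dot v v + 2 * tau * (dot v k - dot v v) + tau * (tau * dot (k - v) (k - v)).
  rewrite !(dotDl, dotDr, dotZl, dotZr, dotNl, dotNr) (dotC _ k v); ring.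
have : tau * (tau * dot (k - v) (k - v)) <= tau * (d / 2).
  rewrite ler_pM2l // (_ : d / 2 = tau * B); last by rewrite -tauB; field.
  by rewrite ler_pM2l.
have dv := dle _ Kv.
move=> h1 h2.
have : 0 <= tau * (2 * dot v k - 2 * dot v v + d) by nra.
by rewrite pmulr_rge0 //; lra.
Qed.

End Dot.

(** * From points of the thickened hull to feasible points of the cone program *)

Section Socp.
Variables (R : realType) (s m : nat).
Variables (ubar : 'I_m -> 'cV[R]_s) (alpha : 'I_m -> R).

Let U : 'M[R]_(m, s) := \matrix_(i < m) (alpha i *: (ubar i)^T).
Let a : 'cV[R]_m := \col_i alpha i.

(** Up to sign, the first [s] weights act as a displacement, the last [m] combine the points
    [(alpha_i ubar_i, alpha_i)], and the middle weight only fills the last coordinate. *)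
Lemma Abar_tr_mul (x : 'cV[R]_s) (l : R) (mu : 'cV[R]_m) :
  (Abar ubar alpha)^T *m col_mx x (col_mx l%:M mu) =
  - col_mx (x + U^T *m mu) (col_mx (a^T *m mu) l%:M).
Proof.
have -> : Abar ubar alpha = col_mx (row_mx (- 1%:M) 0)
    (col_mx (row_mx 0 (row_mx 0 (- 1)%:M)) (row_mx (- U) (row_mx (- a) 0))).
  rewrite /Abar; congr col_mx; last congr col_mx.
  - apply/row_matrixP => i; rewrite rowK row_row_mx row0 row_mx0.
    congr row_mx; apply/rowP => j; rewrite !mxE.
    by rewrite eqxx andbT eq_sym.
  - apply/row_matrixP => i; rewrite rowK !row_row_mx row0.
    congr row_mx; last congr row_mx; apply/rowP => j; rewrite !mxE ?mulNr //.
    by rewrite ord1 eqxx.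
rewrite !tr_col_mx !mul_row_col !tr_row_mx !mul_col_mx !add_col_mx.
rewrite !linearN /= !trmx0 !trmx1 !mulNmx !mul0mx !add0r !addr0 mul1mx tr_scalar_mx.
by rewrite -scalar_mxM mulN1r !opp_col_mx opprD raddfN.
Qed.

Lemma socp_feasible_hull (F : R) (x : 'cV[R]_s) (mu : 'cV[R]_m) : 0 <= F ->
  dot x x <= F ^+ 2 -> (forall i, 0 <= mu i 0) -> \sum_i mu i 0 = 1 ->
  let k := col_mx (x + U^T *m mu) (a^T *m mu) in
  exists z sigma lambda, socp_feasible ubar alpha z sigma
    (Num.sqrt (dot k k + F ^+ 2) / (1 + F)) lambda.
Proof.
move=> F0 xF mu0 mu1 k.
have F1 : 0 < 1 + F by rewrite ltr_wpDr.
set c := (1 + F)^-1; have c0 : 0 <= c by rewrite invr_ge0 ltW.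
have cF : c + F * c = 1.
  by rewrite -{1}[c]mul1r -mulrDl mulfV // gt_eqF.
have lamE : c *: col_mx x (col_mx F%:M mu) =
    col_mx (c *: x) (col_mx (c * F)%:M (c *: mu)).
  by rewrite !scale_col_mx scale_scalar_mx.
(* The weights [F] and [mu] add up to [1 + F], so the factor [c] normalizes them; the cone
   constraint becomes [|x| <= F]. The choice [sigma = 0] is allowed since [bbar] and the data
   weights are nonnegative. *)
exists ((Abar ubar alpha)^T *m (c *: col_mx x (col_mx F%:M mu))), 0,
  (c *: col_mx x (col_mx F%:M mu)).
split => //.
- have kF : 0 <= dot k k + F ^+ 2 by rewrite addr_ge0 ?dot_ge0 ?sqr_ge0.
  rewrite enorm_le ?mulr_ge0 ?sqrtr_ge0 // exprMn sqr_sqrtr //.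
  rewrite -scalemxAr Abar_tr_mul dot_col_mx dot_scalar_mx mulr0 addr0.
  rewrite dotZl dotZr dotNl dotNr opprK !dot_col_mx dot_scalar_mx.
  rewrite -/c le_eqVlt; apply/orP; left; apply/eqP; ring.
- rewrite lamE /bbar !dot_col_mx oppr_le0 /dot trmx0 mul0mx trmx0 mul0mx.
  rewrite !mxE !add0r sumr_ge0 // => i _.
  by rewrite !mxE mul1r mulr_ge0.
- rewrite lamE col_mxKu col_mxKd.
  have -> : col_mx (c * F)%:M (c *: mu) (lshift m ord0) 0 = c * F.
    by rewrite col_mxEu mxE eqxx.
  rewrite enorm_le ?mulr_ge0 // dotZl dotZr exprMn mulrA -expr2.
  by rewrite ler_wpM2l ?sqr_ge0.
- rewrite lamE col_mxKd; split.
    rewrite big_split_ord /= big_ord1 col_mxEu mxE eqxx mulr1n.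
    under eq_bigr do rewrite col_mxEd mxE.
    by rewrite -mulr_sumr mu1 mulr1 addrC [c * F]mulrC.
  move=> i; rewrite -(fintype.splitK i); case: (fintype.split i) => j /=.
    by rewrite col_mxEu ord1 mxE eqxx mulr1n mulr_ge0.
  by rewrite col_mxEd mxE mulr_ge0.
Qed.

End Socp.

(** * Finiteness of the optimal value, and robust feasibility when it is positive *)

Section Value.
Variables (R : realType) (s m : nat).
Variables (ubar : 'I_m -> 'cV[R]_s) (alpha : 'I_m -> R).

Lemma socp_value_ge0 : (0 <= socp_value ubar alpha)%E.
Proof.
apply/ereal_infP => _ [t [z [sigma [l [h _ _ _ _]]]] <-].
by rewrite lee_fin (le_trans _ h) // /enorm sqrtr_ge0.
Qed.

(** Putting all the weight on index [s+1] gives a feasible point. *)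
Lemma socp_value_lt_pinfty : (socp_value ubar alpha < +oo)%E.
Proof.
set z := (Abar ubar alpha)^T *m col_mx 0 (col_mx 1%:M 0).
apply: (@le_lt_trans _ _ (enorm (col_mx z 0%:M))%:E); last exact: ltry.
apply: ereal_inf_lbound; exists (enorm (col_mx z 0%:M)) => //.
exists z, 0, (col_mx 0 (col_mx 1%:M 0)); split => //.
- rewrite /bbar !dot_col_mx /dot trmx0 mul0mx trmx0 mul0mx mulmx0.
  by rewrite !mxE !addr0 oppr0.
- rewrite col_mxKu col_mxKd col_mxEu mxE eqxx enorm_le // /dot mulmx0 mxE.
  exact: sqr_ge0.
- rewrite col_mxKd; split.
    rewrite big_split_ord /= big_ord1 col_mxEu mxE eqxx.
    by rewrite big1 ?addr0 // => i _; rewrite col_mxEd mxE.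
  move=> i; rewrite -(fintype.splitK i); case: (fintype.split i) => j /=.
    by rewrite col_mxEu ord1 mxE eqxx.
  by rewrite col_mxEd mxE.
Qed.

Lemma tr_mulmx_delta n (M : 'M[R]_(m, n)) i :
  M^T *m delta_mx i (0 : 'I_1) = (row i M)^T.
Proof. by rewrite rowE trmx_mul trmx_delta. Qed.

Lemma robust_svm_feasible_value (F : R) (r : 'I_m -> R) :
  (forall i, alpha i = - 1 \/ alpha i = 1) ->
  socp_value ubar alpha = F%:E -> 0 < F -> (forall i, 0 <= r i <= F) ->
  robust_svm_feasible ubar alpha r !=set0.
Proof.
move=> alphaP vF F0 rF.
pose U : 'M[R]_(m, s) := \matrix_(i < m) (alpha i *: (ubar i)^T).
pose a : 'cV[R]_m := \col_i alpha i.
pose pt (x : 'cV[R]_s) (mu : 'cV[R]_m) : 'cV[R]_(s + 1) :=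
  col_mx (x + U^T *m mu) (a^T *m mu).
pose K := [set k | exists x (mu : 'cV[R]_m),
  [/\ dot x x <= F ^+ 2, forall i, 0 <= mu i 0, \sum_i mu i 0 = 1 & k = pt x mu]].
(* [G] consists of the thickened vertices of the hull [K]; the robust constraints only involve these
   points. *)
pose G := [set k | exists2 x, dot x x <= F ^+ 2 &
  exists i, k = pt x (delta_mx i 0)].
have alpha2 i : alpha i * alpha i = 1.
  by case: (alphaP i) => ->; rewrite ?mulrNN mulr1.
have ptE x i : pt x (delta_mx i 0) = col_mx (x + alpha i *: ubar i) (alpha i)%:M.
  rewrite /pt !tr_mulmx_delta rowK linearZ /= trmxK; congr col_mx.
  by apply/colP => j; rewrite !mxE !ord1 eqxx.
(* The lower bound is [F <= sqrt (|k|^2 + F^2) / (1 + F)] solved for [|k|^2]. The upper bound comes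
   from [|x + y|^2 <= 2 |x|^2 + 2 |y|^2], with [1] for the last coordinate [alpha_i]. *)
have [|||||v [e [e0 ve]]] := @separate_from_origin R _ K G
  (F ^+ 2 * ((1 + F) ^+ 2 - 1)) (2 * F ^+ 2 + 2 * (\sum_i dot (ubar i) (ubar i)) + 1).
- move=> _ _ t [x [mu [xF mu0 mu1 ->]]] [x' [mu' [x'F mu'0 mu'1 ->]]] t01.
  exists (x + t *: (x' - x)), (mu + t *: (mu' - mu)); split.
  + exact: dot_conv_le.
  + move=> i; rewrite !mxE; have := mu0 i; have := mu'0 i.
    by move/andP: t01 => [t0 t1]; nra.
  + under eq_bigr do rewrite !mxE.
    by rewrite big_split /= -mulr_sumr sumrB mu1 mu'1 subrr mulr0 addr0.
  + rewrite /pt !mulmxDr -!scalemxAr !mulmxBr opp_col_mx add_col_mx.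
    rewrite scale_col_mx add_col_mx; congr col_mx.
    by rewrite opprD addrACA scalerDr addrACA.
- by rewrite mulr_gt0 ?exprn_gt0 //; nra.
- move=> k [x [mu [xF mu0 mu1 ->]]].
  have [z [sigma [l feas]]] := socp_feasible_hull _ _ _ ubar alpha F x mu
    (ltW F0) xF mu0 mu1.
  rewrite -/U -/a -/(pt x mu) in feas.
  have : (socp_value ubar alpha <=
    (Num.sqrt (dot (pt x mu) (pt x mu) + F ^+ 2) / (1 + F))%:E)%E.
    by apply: ereal_inf_lbound; eexists; [exists z, sigma, l; exact: feas|].
  have F1 : 0 < 1 + F by lra.
  rewrite vF lee_fin ler_pdivlMr // => FF.
  have D0 : 0 <= dot (pt x mu) (pt x mu) + F ^+ 2.
    by rewrite addr_ge0 ?dot_ge0 ?sqr_ge0.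
  have : (F * (1 + F)) ^+ 2 <= dot (pt x mu) (pt x mu) + F ^+ 2.
    rewrite -(sqr_sqrtr D0) lerXn2r // nnegrE ?sqrtr_ge0 //.
    by rewrite mulr_ge0 ?(ltW F0) ?(ltW F1).
  by rewrite exprMn mulrBr mulr1 lerBlDr.
- move=> k [x xF [i ->]]; exists x, (delta_mx i 0); split => //.
    by move=> j; rewrite mxE eqxx andbT ler0n.
  rewrite (bigD1 i) //= mxE !eqxx big1 ?addr0 // => j ji.
  by rewrite mxE (negbTE ji).
- move=> k [x xF [i ->]]; rewrite ptE dot_col_mx dot_scalar_mx alpha2 lerD2r.
  have := dot_ge0 _ _ (x - alpha i *: ubar i).
  have : dot (ubar i) (ubar i) <= \sum_j dot (ubar j) (ubar j).
    by rewrite (bigD1 i) //= lerDl sumr_ge0 // => j _; exact: dot_ge0.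
  have : alpha i * alpha i * dot (ubar i) (ubar i) = dot (ubar i) (ubar i).
    by rewrite alpha2 mul1r.
  rewrite !(dotDl, dotDr, dotZl, dotZr, dotNl, dotNr).
  rewrite (dotC _ _ (ubar i) x); nra.
pose w := usubmx v; pose g := dsubmx v 0 0.
have vE : v = col_mx w g%:M.
  rewrite -[v in LHS]vsubmxK; congr col_mx.
  by apply/colP => j; rewrite !ord1 [RHS]mxE eqxx.
(* Dividing by [e] turns the separation margin [e] into the required margin [1]. *)
exists (e^-1 *: w, e^-1 * g) => i _ [b b1 <-] /=.
rewrite -(@ler_pM2l _ e) // mulr1.
(* The factor [alpha i] makes the first block of this point [alpha i *: (ubar i + r i *: b)]; the
   displacement has length at most [r i <= F]. *)
have Ge : G (pt ((alpha i * r i) *: b) (delta_mx i 0)).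
  exists ((alpha i * r i) *: b); last by exists i.
  have /andP[r0 rle] := rF i.
  rewrite dotZl dotZr mulrA mulrACA alpha2 mul1r.
  have b1' : dot b b <= 1 by move: b1; rewrite /eball /= enorm_le // expr1n.
  have := dot_ge0 _ _ b; nra.
apply: le_trans (ve _ Ge) _; rewrite vE ptE dot_col_mx dot_scalar_mx.
rewrite !(dotDl, dotDr, dotZl, dotZr) (dotC _ _ (ubar i)) (dotC _ _ b).
rewrite le_eqVlt; apply/orP; left; apply/eqP.
by field; rewrite gt_eqF.
Qed.

End Value.

Theorem corollary4p3 (R : realType) (s m : nat)
    (ubar : 'I_m -> 'cV[R]_s) (alpha : 'I_m -> R)
    (alphaP : forall i, alpha i = - 1 \/ alpha i = 1)
    (nominal_feasible : svm_feasible ubar alpha !=set0)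
    (r : 'I_m -> R) (r_ge0 : forall i, 0 <= r i)
    (r_le : forall i, ((r i)%:E <=
       (1 / (Num.sqrt s%:R + 1))%:E * socp_value ubar alpha)%E) :
  robust_svm_feasible ubar alpha r !=set0.
Proof.
have [F vF] : exists F, socp_value ubar alpha = F%:E.
  have := socp_value_ge0 _ _ _ ubar alpha.
  have := socp_value_lt_pinfty _ _ _ ubar alpha.
  by case: (socp_value ubar alpha) => [F _ _|//|//]; exists F.
have F0 : 0 <= F by rewrite -lee_fin -vF; exact: socp_value_ge0.
have rF i : 0 <= r i <= F.
  rewrite r_ge0 /=; have := r_le i; rewrite vF -EFinM lee_fin => /le_trans; apply.
  rewrite ler_piMl // div1r invf_le1 ?ltr_wpDl ?sqrtr_ge0 //.
  by rewrite lerDr sqrtr_ge0.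
(* For [F = 0] the lower bound on the hull degenerates to [0], but then every [r i] is squeezed to
   [0]. *)
have [F00|Fn0] := eqVneq F 0; last first.
  by apply: robust_svm_feasible_value vF _ rF => //; rewrite lt_def Fn0.
have [wg feas] := nominal_feasible; exists wg => i _ [b _ <-].
have -> : r i = 0 by apply/le_anti; have := rF i; rewrite F00 andbC.
by rewrite scale0r addr0; exact: feas.
Qed.
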